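(* Let $(\mathcal X,\psi)$ be a Polish metric space and let $Q$ be a Markov transition kernel on $\mathcal X$ with invariant probability measure $\pi$. Let $\Lambda:\mathcal X\to[0,\infty)$ be measurable with $\Lambda\in L^2(\pi)$, and let $r(n)\ge 0$, $n\ge1$, be a sequence such that $$W_\psi(\delta_xQ^n,\pi)\le \Lambda(x)\,r(n)\qquad\text{for all }x\in\mathcal X,\ n\ge 1 .$$ If $\sum_{n=1}^\infty r(n)<\infty$, then every $g\in\mathcal G_\psi\cap L_0^2(\pi)$ satisfies $$\sum_{k=0}^\infty\|Q^kg\|<\infty .$$
   Context: $(\mathcal X,\psi)$ Polish metric space: complete separable metric space, with its Borel $\sigma$-field. $Q^n$ is the $n$-step kernel ($Q^0$ the identity), $\delta_xQ^n=Q^n(x,\cdot)$, $Qg(x)=\int g(y)\,Q(x,dy)$, and $\pi$ invariant means $\pi Q=\pi$. $W_\psi(\mu,\nu)=\inf_{\Gamma}\int\psi(x,y)\,\Gamma(dx,dy)$ over all couplings $\Gamma$ of $\mu$ and $\nu$ (1-Wasserstein distance). $\mathcal G_\psi=\{g:\mathcal X\to\mathbb R:\ |g(x)-g(y)|\le\psi(x,y)\ \forall x,y\}$. $L^2_0(\pi)=\{g\in L^2(\pi):\int g\,d\pi=0\}$. $\|\cdot\|$ is the $L^2(\pi)$ norm. *)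

(* Defs.v *)
From HB Require Import structures.
From mathcomp Require Import all_boot all_order all_algebra.
From mathcomp Require Import all_classical all_reals all_analysis.
From mathcomp Require Import measurable_realfun.
Set Implicit Arguments.
Unset Strict Implicit.
Unset Printing Implicit Defensive.
Import Order.TTheory GRing.Theory Num.Theory.
Import numFieldNormedType.Exports.
Local Open Scope classical_set_scope.
Local Open Scope ring_scope.

HB.mixin Record isSeparableBorel (d : measure_display) (T : Type)
    & Topological T & Measurable d T := {
  separable_subproof : exists2 D : set T, countable D & dense D ;
  borel_subproof : @measurable d T = <<s [set U : set T | open U] >> }.

(* The metric psi is [mdist].  Pointedness, inherited from [measurableType], is
   no restriction for spaces carrying a probability measure. *)
#[short(type="polishMetricType")]
HB.structure Definition PolishMetric (d : measure_display) (R : realType) :=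
  { T of Metric R T & Complete T & Measurable d T
       & isSeparableBorel d T }.

Section kernel_power.
Context (d : measure_display) (X : measurableType d) (R : realType).

Section comp.
Variables k1 k2 : R.-pker X ~> X.

Definition pkcomp : X -> {measure set X -> \bar R} := mkcomp_noparam k1 k2.

Let measurable_pkcomp U :
  measurable U -> measurable_fun [set: X] (pkcomp ^~ U).
Proof. exact: (measurable_kernel (mkcomp_noparam k1 k2)). Qed.

HB.instance Definition _ :=
  isKernel.Build _ _ X X R pkcomp measurable_pkcomp.

Let pkcomp_prob x : pkcomp x [set: X] = 1%E.
Proof.
transitivity (\int[k1 x]_y (cst 1 y))%E.
  by apply: eq_integral => y _; rewrite prob_kernel.
by rewrite integral_cst// mul1e prob_kernel.
Qed.

HB.instance Definition _ :=
  Kernel_isProbability.Build _ _ X X R pkcomp pkcomp_prob.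

End comp.

(* [kpow Q n.+1 x A = \int[Q x]_y kpow Q n y A] *)
Fixpoint kpow (Q : R.-pker X ~> X) (n : nat) : R.-pker X ~> X :=
  if n is m.+1 then pkcomp Q (kpow Q m)
  else kdirac (@measurable_id _ X [set: X]).

End kernel_power.

Section markov.
Context (d : measure_display) (X : measurableType d) (R : realType).
Local Open Scope ereal_scope.

Definition kact (Q : R.-pker X ~> X) (g : X -> R) : X -> \bar R :=
  fun x => \int[Q x]_y (g y)%:E.

Definition kinvariant (pi : probability X R) (Q : R.-pker X ~> X) :=
  forall A : set X, measurable A -> \int[pi]_x Q x A = pi A.

Definition L2_0 (pi : probability X R) : set (X -> R) :=
  [set g | g \in Lfun pi 2%:E /\ \int[pi]_x (g x)%:E = 0].

Definition coupling (mu nu : {measure set X -> \bar R})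
    : set (probability (X * X)%type R) :=
  [set G | forall A : set X, measurable A ->
     G (A `*` [set: X]) = mu A /\ G ([set: X] `*` A) = nu A].

End markov.

Section metric.
Context (d : measure_display) (R : realType) (X : polishMetricType d R).

(* The product sigma-field carried by [X * X] is the Borel one, since X is
   separable.  The infimum takes its values in [0, +oo]. *)
Definition wasserstein (mu nu : {measure set X -> \bar R}) : \bar R :=
  ereal_inf [set \int[G]_z (mdist z.1 z.2)%:E | G in coupling mu nu]%E.

Definition lip1 : set (X -> R) :=
  [set g | forall x y, `|g x - g y| <= mdist x y].

End metric.

(* Main.v *)
(* For a 1-Lipschitz g of mean zero, integrating g x - g y against couplings of
   Q^n(x, .) and pi gives |Q^n g x| <= W(Q^n(x, .), pi) <= Lam x * r n, hence
   ||Q^n g|| <= r n * ||Lam|| for n >= 1, which is summable. *)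
Require Import Defs.
From HB Require Import structures.
From mathcomp Require Import all_boot all_order all_algebra.
From mathcomp Require Import all_classical all_reals all_analysis.
From mathcomp Require Import measurable_realfun.
Set Implicit Arguments.
Unset Strict Implicit.
Unset Printing Implicit Defensive.
Import Order.TTheory GRing.Theory Num.Theory.
Import numFieldNormedType.Exports.
Local Open Scope classical_set_scope.
Local Open Scope ring_scope.

(* Unlike in [ge0_le_integral], [f1] and [f2] need not be measurable; this spares
   the joint measurability of [mdist] and the measurability of [kact]. *)
Lemma integral_mono d (T : measurableType d) (R : realType)
    (mu : {measure set T -> \bar R}) (f1 f2 : T -> \bar R) :
  (forall x, 0 <= f1 x)%E -> (forall x, f1 x <= f2 x)%E ->
  (\int[mu]_x f1 x <= \int[mu]_x f2 x)%E.
Proof.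
move=> f10 f12; have f20 x : (0 <= f2 x)%E := le_trans (f10 x) (f12 x).
(* For a nonnegative function the integral is a supremum over the simple functions below it, and
   each one below [f1] is also below [f2]. *)
rewrite !ge0_integralTE//; apply: ereal_sup_le => _ [h /= hf <-].
by exists h => // x; exact: le_trans (hf x) (f12 x).
Qed.

Lemma Lnorm_mono d (T : measurableType d) (R : realType)
    (mu : {measure set T -> \bar R}) (p : R) (f1 f2 : T -> \bar R) :
  0 <= p -> (forall x, `|f1 x| <= `|f2 x|)%E ->
  ('N[mu]_p%:E[f1] <= 'N[mu]_p%:E[f2])%E.
Proof.
move=> p0 f12; rewrite unlock; apply: gt0_ler_poweR.
- by rewrite invr_ge0.
- by rewrite in_itv/= leey andbT; apply: integral_ge0 => x _; exact: poweR_ge0.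
- by rewrite in_itv/= leey andbT; apply: integral_ge0 => x _; exact: poweR_ge0.
apply: integral_mono => x; first exact: poweR_ge0.
by apply: gt0_ler_poweR => //; rewrite in_itv/= leey andbT.
Qed.

Section image_measure.
Context d1 d2 (X : measurableType d1) (Y : measurableType d2) (R : realType).
Variables (G : {measure set X -> \bar R}) (mu : {measure set Y -> \bar R}).
Variables (phi : X -> Y) (mphi : measurable_fun [set: X] phi).
Hypothesis muE : forall A, measurable A -> mu A = G (phi @^-1` A).
Variable f : Y -> \bar R.

(** Meant for the marginals of a coupling: [phi] is a projection and [muE] identifies [mu] with the
    pushforward of [G]. *)
Lemma integrable_image :
  mu.-integrable [set: Y] f -> G.-integrable [set: X] (f \o phi).
Proof.
move=> /integrableP[mf foo]; apply/integrableP; split.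
  exact: measurableT_comp.
move: foo; rewrite (@eq_measure_integral _ _ _ _ (pushforward G phi)).
rewrite ge0_integral_pushforward//.
  exact: measurableT_comp.
by move=> A mA _; exact: muE.
Qed.

Lemma integral_image : measurable_fun [set: Y] f ->
  G.-integrable [set: X] (f \o phi) ->
  (\int[mu]_y f y = \int[G]_x (f \o phi) x)%E.
Proof.
move=> mf intf; rewrite (@eq_measure_integral _ _ _ _ (pushforward G phi)).
  by rewrite integral_pushforward.
by move=> A mA _; exact: muE.
Qed.

End image_measure.

(** The difference [g z.1 - g z.2] is dominated by the distance, and its [G]-integral is the
    [mu]-integral of [g] minus the [nu]-integral, which vanishes. *)
Lemma lip1_integral_le_coupling d (R : realType) (X : polishMetricType d R)
    (mu nu : {measure set X -> \bar R}) (G : probability (X * X)%type R)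
    (g : X -> R) :
  coupling mu nu G -> lip1 g -> nu.-integrable [set: X] (EFin \o g) ->
  (\int[nu]_x (g x)%:E = 0)%E ->
  (\int[G]_z (mdist z.1 z.2)%:E < +oo)%E ->
  (`|\int[mu]_x (g x)%:E| <= \int[G]_z (mdist z.1 z.2)%:E)%E.
Proof.
move=> Gmn glip gint g0 Goo.
have mg : measurable_fun [set: X] (EFin \o g) by case/integrableP: gint.
have mu1 A : measurable A -> mu A = G (fst @^-1` A).
  by move=> /Gmn[<- _]; congr (G _); apply/seteqP; split => z/=; tauto.
have nu2 A : measurable A -> nu A = G (snd @^-1` A).
  by move=> /Gmn[_ <-]; congr (G _); apply/seteqP; split => z/=; tauto.
have i2 := integrable_image measurable_snd nu2 gint.
pose D (z : X * X) := ((EFin \o g) z.1 - (EFin \o g) z.2)%E.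
have mD : measurable_fun [set: X * X] D.
  by apply: emeasurable_funB; apply: measurableT_comp mg _.
have Dle : (\int[G]_z `|D z| <= \int[G]_z (mdist z.1 z.2)%:E)%E.
  by apply: integral_mono => // z; rewrite lee_fin; exact: glip.
have iD : G.-integrable [set: X * X] D.
  by apply/integrableP; split => //; exact: le_lt_trans Dle Goo.
(* Integrability of [g] under [mu] is not assumed; it comes from finite cost, by writing [g z.1] as
   [D z + g z.2]. *)
have i1 : G.-integrable [set: X * X] ((EFin \o g) \o fst).
  apply: eq_integrable (integrableD measurableT iD i2) => // z _.
  by rewrite /D /= -EFinB -EFinD subrK.
rewrite (integral_image measurable_fst mu1 mg i1).
have -> : (\int[G]_z ((EFin \o g) \o fst) z = \int[G]_z D z)%E.
  rewrite integralB//= -[X in (_ - X)%E](integral_image measurable_snd nu2 mg i2).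
  by rewrite [X in (_ - X)%E]g0 sube0.
exact: le_trans (le_abse_integral _ measurableT mD) Dle.
Qed.

(* The easy half of Kantorovich--Rubinstein duality. *)
Lemma lip1_integral_le_wasserstein d (R : realType) (X : polishMetricType d R)
    (mu nu : {measure set X -> \bar R}) (g : X -> R) :
  lip1 g -> nu.-integrable [set: X] (EFin \o g) ->
  (\int[nu]_x (g x)%:E = 0)%E ->
  (`|\int[mu]_x (g x)%:E| <= wasserstein mu nu)%E.
Proof.
move=> glip gint g0; apply/ereal_infP => _ [G Gmn <-].
(* A coupling of infinite cost gives a trivial bound; only finite cost makes the difference
   integrable. *)
have [->|] := eqVneq (\int[G]_z (mdist z.1 z.2)%:E)%E +oo%E.
  by rewrite leey.
rewrite -ltey; exact: (lip1_integral_le_coupling Gmn glip gint g0).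
Qed.

Theorem corollary1 (d : measure_display) (R : realType)
    (X : polishMetricType d R) (Q : R.-pker X ~> X) (pi : probability X R)
    (pi_inv : kinvariant pi Q)
    (Lam : X -> R) (Lam_ge0 : forall x, 0 <= Lam x)
    (Lam_L2 : Lam \in Lfun pi 2%:E)
    (r : nat -> R) (r_ge0 : forall n, (1 <= n)%N -> 0 <= r n)
    (rate : forall (x : X) (n : nat), (1 <= n)%N ->
      (wasserstein (kpow Q n x) pi <= (Lam x * r n)%:E)%E)
    (r_sum : (\sum_(1 <= n <oo) (r n)%:E < +oo)%E)
    (g : X -> R) (g_in : (@lip1 d R X `&` L2_0 pi) g) :
  (\sum_(0 <= k <oo) 'N[pi]_2%:E[kact (kpow Q k) g] < +oo)%E.
Proof.
case: g_in => glip [gL2 g0].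
have piT : pi [set: X] \is a fin_num by rewrite probability_setT.
have gint : pi.-integrable [set: X] (EFin \o g).
  by apply/Lfun1_integrable; exact: Lfun_subset12.
have mg : measurable_fun [set: X] (EFin \o g) by case/integrableP: gint.
have finN (f : X -> R) : f \in Lfun pi 2%:E -> ('N[pi]_2%:E[EFin \o f] < +oo)%E.
  by move=> /andP[_]; rewrite inE.
have step n : (1 <= n)%N ->
    ('N[pi]_2%:E[kact (kpow Q n) g] <= (r n)%:E * 'N[pi]_2%:E[EFin \o Lam])%E.
  move=> n1; have p1 : (1 <= 2%:E :> \bar R)%E by rewrite lee_fin ler1n.
  (* Moving [r n] inside the norm reduces the claim to a pointwise comparison with [r n * Lam x]. *)
  have := LnormZ (Lfun_Sub p1 Lam_L2) (r n).
  rewrite ger0_norm ?r_ge0// => <-; apply: Lnorm_mono => // x.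
  rewrite (le_trans (lip1_integral_le_wasserstein _ glip gint g0))//.
  rewrite (le_trans (rate x n n1))// lee_fin /= mulrC.
  exact: ler_norm.
(* The rate says nothing at [n = 0]. That term is split off: [kpow Q 0] is the Dirac kernel, so it
   equals the finite norm of [g]. *)
rewrite nneseries_recl//; last by move=> k _; exact: Lnorm_ge0.
rewrite lte_add_pinfty//.
  rewrite (_ : kact _ g = EFin \o g) ?finN//; apply/funext => x.
  by rewrite /kact /= integral_dirac// diracE in_setT mul1e.
have LamN : ('N[pi]_2%:E[EFin \o Lam])%E \is a fin_num.
  by rewrite ge0_fin_numE ?Lnorm_ge0// finN.
(* The sign of [r 0] is unknown, whereas shifting the index asks for nonnegative terms at every
   index; absolute values provide this and leave the sum from 1 unchanged. *)
have rE : (\sum_(1 <= n <oo) (r n)%:E = \sum_(1 <= n <oo) `|r n|%:E)%E.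
  congr (limn _); apply/funext => m; apply: eq_big_nat => n /andP[n1 _].
  by rewrite ger0_norm ?r_ge0.
have r1_sum : (\sum_(0 <= n <oo) `|r (n + 1)%N|%:E < +oo)%E.
  by rewrite (nneseries_addn (f := fun n => `|r n|%:E))// -rE.
rewrite -nneseries_addn; last by move=> k; exact: Lnorm_ge0.
(* The norm of [Lam] is finite, so [fine] turns it into a real constant that factors out of the
   series. *)
apply: (@le_lt_trans _ _ (\sum_(0 <= k <oo)
    (fine 'N[pi]_2%:E[EFin \o Lam])%:E * `|r (k + 1)%N|%:E)%E).
  apply: lee_nneseries => [k _ _|k _]; first exact: Lnorm_ge0.
  by rewrite fineK// muleC ger0_norm ?r_ge0 ?addn1//; exact: step.
by rewrite nneseriesZl// lte_mul_pinfty// lee_fin fine_ge0// Lnorm_ge0.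
Qed.
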